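(* Let $f$ be a smooth function on $\mathbb{E}^3$ which is homogeneous of degree $m$, i.e. $(\mathbf{x},f_{\mathbf{x}}(x))=m f(x)$, let $c\neq 0$, and consider the homogeneous surface $\{f(x)=c\}$. Assume that $\|f_{\mathbf{x}}(x)\|^2$ depends only on $f$ and $r$, i.e. there is a function $g$ of two variables such that $\|f_{\mathbf{x}}(x)\|^2=g(f(x),r)$. Then the geodesic flow on the surface $f(x)=c$ is integrable.
   Context: $\mathbb{E}^3$ is three-dimensional Euclidean space with Cartesian coordinates $\mathbf{x}=x=(x_1,x_2,x_3)$ and scalar product $(\,,\,)$; $r=\sqrt{x_1^2+x_2^2+x_3^2}$; $f_{\mathbf{x}}=(f_{x_1},f_{x_2},f_{x_3})$ is the gradient. The geodesic flow on $\{f=c\}$ is given by $\ddot{\mathbf{x}}=\lambda f_{\mathbf{x}}(x)$, with $\lambda$ the multiplier that keeps the motion on the surface; it admits the energy integral $\|\dot{\mathbf{x}}\|^2$. The geodesic flow is called integrable if there is an additional first integral functionally independent of the energy integral. *)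

(* Defs.v *)
From HB Require Import structures.
From mathcomp Require Import all_boot all_order all_algebra.
From mathcomp Require Import all_classical all_reals all_analysis.

Set Implicit Arguments.
Unset Strict Implicit.
Unset Printing Implicit Defensive.

Import Order.TTheory GRing.Theory Num.Theory.
Import numFieldNormedType.Exports.

Local Open Scope classical_set_scope.
Local Open Scope ring_scope.

(* The canonical norm `|x| on 'rV[R]_n is the sup norm; the Euclidean scalar
   product and norm are therefore introduced separately. *)
Definition dot (R : realType) (n : nat) (u v : 'rV[R]_n) : R :=
  \sum_(i < n) u 0 i * v 0 i.

Definition enorm (R : realType) (n : nat) (u : 'rV[R]_n) : R :=
  Num.sqrt (dot u u).

Definition grad (R : realType) (n : nat) (f : 'rV[R]_n -> R) (x : 'rV[R]_n) :
    'rV[R]_n :=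
  \row_(i < n) 'D_(delta_mx 0 i) f x.

Definition iter_derive (R : realType) (V : normedModType R) (s : seq V)
    (f : V -> R) : V -> R :=
  foldr (fun (v : V) (h : V -> R) => (fun x => 'D_v h x)) f s.

(* C^oo on the whole (finite-dimensional) space V. *)
Definition smooth (R : realType) (V : normedModType R) (f : V -> R) : Prop :=
  forall (s : seq V) (x : V), differentiable (iter_derive s f) x.

Section GeodesicFlow.
Context {R : realType}.
Local Notation E3 := 'rV[R]_3.
Implicit Types (f : E3 -> R) (c : R) (F : E3 * E3 -> R).

(* Geodesics are taken on arbitrary open intervals J, not only the maximal
   ones. Where grad f does not vanish, the multiplier lambda is determined by
   the constraint f (gamma t) = c. *)
Definition is_geodesic f c (J : set R) (gamma : R -> E3) : Prop :=
  exists lambda : R -> R, forall t, J t ->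
    [/\ f (gamma t) = c,
        derivable gamma t 1,
        derivable (derive1 gamma) t 1
      & derive1 (derive1 gamma) t = lambda t *: grad f (gamma t)].

(* The tangent bundle of {f = c}, as the set of pairs (position, velocity). *)
Definition phase_space f c : set (E3 * E3) :=
  [set p | f p.1 = c /\ dot (grad f p.1) p.2 = 0].

(* The tangent space of the phase space at p: the kernel of the differentials
   of its two defining functions. *)
Definition phase_tangent f (p : E3 * E3) : set (E3 * E3) :=
  [set w | 'D_w (fun q : E3 * E3 => f q.1) p = 0 /\
           'D_w (fun q : E3 * E3 => dot (grad f q.1) q.2) p = 0].

Definition energy (p : E3 * E3) : R := enorm p.2 ^+ 2.

(* The phase space is closed in E3 * E3, so a smooth function on it is the
   restriction of a smooth function on E3 * E3; only the values of F on the
   phase space matter here, since (gamma t, gamma' t) lies in it. *)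
Definition first_integral f c F : Prop :=
  smooth F /\
  forall (J : set R) (gamma : R -> E3),
    open J -> is_interval J -> is_geodesic f c J gamma ->
    forall s t, J s -> J t ->
      F (gamma s, derive1 gamma s) = F (gamma t, derive1 gamma t).

Definition independent_at f F G (p : E3 * E3) : Prop :=
  forall a b : R,
    (forall w, phase_tangent f p w -> a * 'D_w F p + b * 'D_w G p = 0) ->
    a = 0 /\ b = 0.

(* The differentials of F and G, restricted to the phase space, are linearly
   independent on a dense subset of the phase space. *)
Definition functionally_independent f c F G : Prop :=
  phase_space f c `<=`
    closure (phase_space f c `&` [set p | independent_at f F G p]).

Definition geodesic_flow_integrable f c : Prop :=
  exists F, first_integral f c F /\ functionally_independent f c F energy.

End GeodesicFlow.

(* Main.v *)
Require Import Defs.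
From HB Require Import structures.
From mathcomp Require Import all_boot all_order all_algebra.
From mathcomp Require Import all_classical all_reals all_analysis.
From mathcomp Require Import ring lra.
Import Order.TTheory GRing.Theory Num.Theory.
Import numFieldNormedType.Exports.
Local Open Scope classical_set_scope.
Local Open Scope ring_scope.

(** A surface as in the theorem is a surface of revolution, and the first
    integral is the one of Clairaut: if the axis is spanned by [a], the moment
    [(cross a gamma, gamma')] is constant along the geodesics, because [cross a gamma]
    is tangent to the surface while the acceleration is normal to it.

    Why there is an axis.  Let [n(x) = cross x (grad f x)], a normal vector of the
    plane spanned by the position and the gradient; [a] is an axis exactly when
    [n] takes its values in the plane orthogonal to [a].

    - The Euler relation and smoothness at the origin force [f] and all its
      derivatives to be polynomial on every line ([line_poly_euler]).
    - A curve on a sphere around [0] along which [f] is constant is also a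
      curve along which the length of [grad f] is constant.  Its velocity is
      proportional to [n(x)], so differentiating gives [(n, H grad f) = 0] with
      [H] the Hessian matrix: [H grad f] lies in the plane of [x] and [grad f]
      ([hess_in_plane]).
    - Hence that plane is invariant: all along the plane through [0] orthogonal
      to [n(x)], the gradient stays in this plane ([normal_plane]).  It is a
      uniqueness statement for a linear differential equation, here with
      polynomial coefficients.
    - On the intersection of two such planes the gradient is orthogonal to both
      normals, so it is radial and [n] vanishes there
      ([meridian_normal_cross]).
    - Fix [x1] with [n(x1) <> 0].  On the plane orthogonal to [n(x1)], the field
      [n] is polynomial and not identically [0], so it vanishes along finitely
      many lines through [0] only.  The traces of all the other planes are
      among them and depend algebraically on the plane, so they are all the
      same line ([normals_coplanar]): this line is the axis
      ([normals_axis]).  If [n] vanishes identically, [f] is radial and every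
      line is an axis.

    Independence.  Varying the velocity alone shows that the moment and the
    energy are independent at [(x, v)] as soon as [v] is not proportional to
    [cross a x] ([moment_independent]).  To approach a given point of the phase
    space by such points, leave the axis inside the surface, which homogeneity
    permits by rescaling a nearby point ([off_axis_dense]), then tilt the
    velocity ([independent_dense]). *)

Set Implicit Arguments.
Unset Strict Implicit.
Unset Printing Implicit Defensive.

(** * Directional derivatives *)

Section Calculus.
Context {R : realType} {V : normedModType R}.
Implicit Types (f : V -> R) (x u v : V).

Lemma smooth_differentiable f x : smooth f -> differentiable f x.
Proof. by move=> sf; exact: (sf [::] x). Qed.

Lemma smooth_derive f v : smooth f -> smooth (fun x => 'D_v f x).
Proof.
move=> sf s x; rewrite /iter_derive -[X in foldr _ X _]/((fun x => 'D_v f x)).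
have := sf (rcons s v) x; by rewrite /iter_derive foldr_rcons.
Qed.

Lemma is_derive_line f x v (t : R) : differentiable f (x + t *: v) ->
  is_derive t 1 (fun s : R => f (x + s *: v)) ('D_v f (x + t *: v)).
Proof.
move=> df; have := @diff_derivable R V R f (x + t *: v) v df => /derivableP [].
have E : (fun h : R => h^-1 *: ((f \o shift (x + t *: v)) (h *: v) - f (x + t *: v)))
   = (fun h : R => h^-1 *: (((fun s : R => f (x + s *: v)) \o shift t) (h *: 1) - f (x + t *: v))).
  apply/funext => h /=; congr (_ *: (f _ - _)).
  by rewrite [h *: 1]mulr1 scalerDl addrCA.
by rewrite /derivable /derive E => d1 d2; split.
Qed.

Lemma is_derive_curve {W : normedModType R} (f : V -> W) (gamma : R -> V) (t : R) (w : V) :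
  differentiable f (gamma t) -> is_derive t 1 gamma w ->
  is_derive t 1 (fun s => f (gamma s)) ('D_w f (gamma t)).
Proof.
move=> df [dg gE].
have dg' : differentiable gamma t by apply/derivable1_diffP.
have dfg : differentiable (f \o gamma) t by exact: differentiable_comp.
split; first exact: diff_derivable.
by rewrite !deriveE // diff_comp //= -gE deriveE.
Qed.

Lemma deriveDr f x u v : differentiable f x -> 'D_(u + v) f x = 'D_u f x + 'D_v f x.
Proof. by move=> df; rewrite !deriveE // linearD. Qed.

Lemma deriveZr f x (a : R) v : differentiable f x -> 'D_(a *: v) f x = a * 'D_v f x.
Proof. by move=> df; rewrite !deriveE // linearZ. Qed.

Lemma mvt_line f x v (s : R) : (forall y, differentiable f y) -> 0 < s ->
  exists2 t, t \in `]0, s[ & f (x + s *: v) - f x = s * 'D_v f (x + t *: v).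
Proof.
move=> df s0.
have [|||t t0s] := @MVT R (fun t => f (x + t *: v)) (fun t => 'D_v f (x + t *: v)) 0 s.
- by [].
- by move=> t _; exact: is_derive_line.
- apply: derivable_within_continuous => t _.
  by have [] := is_derive_line (df (x + t *: v)).
by rewrite scale0r addr0 subr0 mulrC => E; exists t.
Qed.

(** The mean value theorem applied in the direction [u], then in the direction [v]. *)
Lemma second_difference f x u v (s : R) : smooth f -> 0 < s ->
  exists st : R * R, [/\ st.1 \in `]0, s[, st.2 \in `]0, s[ &
    f (x + s *: u + s *: v) - f (x + s *: u) - (f (x + s *: v) - f x) =
      s * (s * 'D_v (fun y => 'D_u f y) (x + st.1 *: u + st.2 *: v))].
Proof.
move=> sf s0.
pose g y := f (y + s *: v) - f y.
have dshift y : differentiable (fun y => f (y + s *: v)) y.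
  apply: (@differentiable_comp R V V R (fun y => y + s *: v) f) => //.
  exact: smooth_differentiable.
have dg y : differentiable g y.
  by apply: differentiableB => //; exact: smooth_differentiable.
have [t t0s E1] := mvt_line x u dg s0.
have gE : 'D_u g (x + t *: u) =
    'D_u f (x + t *: u + s *: v) - 'D_u f (x + t *: u).
  rewrite deriveB; last 2 first.
  - exact/diff_derivable/dshift.
  - exact/diff_derivable/smooth_differentiable.
  congr (_ - _); apply: (congr1 (fun F : R -> R => lim (F @ 0^'))).
  by apply/funext => h /=; congr (_ *: (f _ - _)); rewrite -addrA.
have [r r0s E2] := mvt_line (x + t *: u) v (fun y => smooth_differentiable y (smooth_derive u sf)) s0.
by exists (t, r); split => //=; rewrite -E2 -gE -E1.
Qed.

(** The second difference is symmetric in the two directions, and divided by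
    [s ^ 2] it tends to either of the two second derivatives. *)
Lemma derive_schwarz f x u v : smooth f ->
  'D_u (fun y => 'D_v f y) x = 'D_v (fun y => 'D_u f y) x.
Proof.
move=> sf.
pose Q (a b : V) (z : R * R) := 'D_b (fun y => 'D_a f y) (x + z.1 *: a + z.2 *: b).
have cQ a b : {for 0, continuous (Q a b)}.
  apply: (@continuous_comp _ _ _ (fun z : R * R => x + z.1 *: a + z.2 *: b)
    (fun y => 'D_b (fun y => 'D_a f y) y)); last first.
    apply: differentiable_continuous.
    exact: (smooth_differentiable _ (smooth_derive b (smooth_derive a sf))).
  apply: cvgD; first apply: cvgD; first exact: cvg_cst.
    apply: cvgZr_tmp; exact: cvg_fst.
  apply: cvgZr_tmp; exact: cvg_snd.
apply/eqP; rewrite -subr_eq0 -normr_le0; apply/ler_addgt0Pr => e e0; rewrite add0r.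
have e20 : 0 < e / 2 by rewrite divr_gt0.
have close a b : exists2 d, 0 < d & forall s t : R, s \in `]0, d[ -> t \in `]0, d[ ->
   `|'D_b (fun y => 'D_a f y) x - Q a b (s, t)| < e / 2.
  have /cvgrPdist_lt /(_ _ e20) := cQ a b.
  rewrite /Q /= !scale0r !addr0 => /nbhs_ballP [d /= d0 H].
  exists d => // s t; rewrite !in_itv /= => /andP[s0 sd] /andP[t0 td].
  apply: (H (s, t)); split => /=; rewrite /ball /= sub0r normrN gtr0_norm //.
have [d1 d10 H1] := close u v; have [d2 d20 H2] := close v u.
pose d := Num.min d1 d2.
have d0 : 0 < d by rewrite lt_min d10.
have sub1 s : s \in `]0, d[ -> (s \in `]0, d1[) * (s \in `]0, d2[).
  by rewrite !in_itv /= lt_min => /andP[-> /andP[-> ->]]; split.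
have [[s t] /= [/sub1[s1 _] /sub1[t1 _] E1]] := second_difference x u v sf d0.
have [[s' t'] /= [/sub1[_ s2] /sub1[_ t2] E2]] := second_difference x v u sf d0.
have L : f (x + d *: u + d *: v) - f (x + d *: u) - (f (x + d *: v) - f x) =
    f (x + d *: v + d *: u) - f (x + d *: v) - (f (x + d *: u) - f x).
  rewrite (addrAC x (d *: u)); move: (f _) (f _) (f _) (f _) => A B C D.
  ring.
have EQ : d * (d * Q u v (s, t)) = d * (d * Q v u (s', t')).
  exact: etrans (esym E1) (etrans L E2).
have {}EQ : Q u v (s, t) = Q v u (s', t').
  by move/(mulfI (lt0r_neq0 d0))/(mulfI (lt0r_neq0 d0)) : EQ.
have := H1 _ _ s1 t1; have := H2 _ _ s2 t2; rewrite EQ; set q := Q _ _ _.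
move: ('D_v _ _) ('D_u _ _) q => A B q h2 h1.
have -> : B - A = (B - q) - (A - q) by ring.
apply: (le_trans (ler_normB _ _)); rewrite [leRHS]splitr.
by apply: lerD; apply: ltW.
Qed.

End Calculus.

Section DirectionalDerivatives.
Context {R : realType}.

Lemma differentiable_bound {V : normedModType R} (f : V -> R) (x : V) (eps : R) :
  differentiable f x -> 0 < eps ->
  exists2 d, 0 < d & forall z, `|z| < d ->
    `|f (z + x) - f x - 'D_z f x| <= eps * `|z|.
Proof.
move=> df e0; have /eqaddoP /(_ eps e0) := diff_locally df.
move=> /nbhs_ballP [d /= d0 H]; exists d => // z zd.
have := H z; rewrite -ball_normE /ball_ /= sub0r normrN => /(_ zd).
by rewrite deriveE // opprD addrA.
Qed.

Lemma deriveZl {V W : normedModType R} (k : V -> R) (v : W) (z w : V) :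
  differentiable k z -> 'D_w (fun s => k s *: v) z = 'D_w k z *: v.
Proof.
move=> dk; rewrite !deriveE //; last exact: differentiableZl.
by rewrite diffZl.
Qed.

Lemma derive_comp {U V : normedModType R} (S : U -> V) (f : V -> R) (z w : U) :
  differentiable S z -> differentiable f (S z) ->
  'D_w (fun s => f (S s)) z = 'D_('D_w S z) f (S z).
Proof.
move=> dS df; rewrite !deriveE //; last exact: (differentiable_comp dS df).
by rewrite (diff_comp dS df).
Qed.

Lemma derive_poly_line {V : normedModType R} (G : V -> R) (p w : V) (q : {poly R}) :
  differentiable G p -> (forall t, G (p + t *: w) = q.[t]) -> 'D_w G p = q^`().[0].
Proof.
move=> dG E.
have := @is_derive_line _ _ G p w 0; rewrite scale0r addr0 => /(_ dG) [_ <-].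
rewrite (_ : (fun s => _) = horner q); last exact/funext.
by have [_ ->] := is_derive_poly q 0.
Qed.

Lemma derive_quadratic {V : normedModType R} (G : V -> R) (p w : V) (c0 c1 c2 : R) :
  differentiable G p -> (forall t, G (p + t *: w) = c0 + t * c1 + t * t * c2) ->
  'D_w G p = c1.
Proof.
move=> dG E; rewrite (derive_poly_line (q := c0%:P + 'X * c1%:P + 'X * 'X * c2%:P) dG).
  by rewrite !(derivD, derivM, derivC, derivX) !hornerE /= !addr0.
by move=> t; rewrite E !hornerE.
Qed.

End DirectionalDerivatives.

(** * Vectors of Euclidean space *)

Section Vectors.
Context {R : realType}.
Local Notation E3 := 'rV[R]_3.
Implicit Types (u v w x y z : E3).

(** Indices of ['I_3] are written as ring numerals, so that the coordinates are
    [0], [1] and [2]. *)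
Definition cross u v : E3 := \row_(i < 3)
  (if i == 0 then u 0 1 * v 0 2%:R - u 0 2%:R * v 0 1
   else if i == 1 then u 0 2%:R * v 0 0 - u 0 0 * v 0 2%:R
   else u 0 0 * v 0 1 - u 0 1 * v 0 0).

Definition det3 u v w : R := dot (cross u v) w.

Lemma dot3E u v : dot u v = u 0 0 * v 0 0 + u 0 1 * v 0 1 + u 0 2%:R * v 0 2%:R.
Proof.
rewrite /dot !big_ord_recl big_ord0 addr0 addrA.
by congr (_ + _ + _); congr (u 0 _ * v 0 _); apply: val_inj.
Qed.

Lemma cross0E u v : cross u v 0 0 = u 0 1 * v 0 2%:R - u 0 2%:R * v 0 1.
Proof. by rewrite mxE. Qed.
Lemma cross1E u v : cross u v 0 1 = u 0 2%:R * v 0 0 - u 0 0 * v 0 2%:R.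
Proof. by rewrite mxE. Qed.
Lemma cross2E u v : cross u v 0 2%:R = u 0 0 * v 0 1 - u 0 1 * v 0 0.
Proof. by rewrite mxE. Qed.

Lemma det3E u v w : det3 u v w =
  (u 0 1 * v 0 2%:R - u 0 2%:R * v 0 1) * w 0 0 +
  (u 0 2%:R * v 0 0 - u 0 0 * v 0 2%:R) * w 0 1 +
  (u 0 0 * v 0 1 - u 0 1 * v 0 0) * w 0 2%:R.
Proof. by rewrite /det3 dot3E cross0E cross1E cross2E. Qed.

Lemma eq_rv3 u v : u 0 0 = v 0 0 -> u 0 1 = v 0 1 -> u 0 2%:R = v 0 2%:R -> u = v.
Proof.
move=> h0 h1 h2; apply/rowP => -[[|[|[|//]]] lti].
- by rewrite (_ : Ordinal lti = 0) //; apply: val_inj.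
- by rewrite (_ : Ordinal lti = 1) //; apply: val_inj.
- by rewrite (_ : Ordinal lti = 2%:R) //; apply: val_inj.
Qed.

Lemma rvDE u v i : (u + v) 0 i = u 0 i + v 0 i. Proof. by rewrite mxE. Qed.
Lemma rvZE a u i : (a *: u) 0 i = a * u 0 i. Proof. by rewrite mxE. Qed.
Lemma rvNE u i : (- u) 0 i = - u 0 i. Proof. by rewrite mxE. Qed.
Lemma rv0E i : (0 : E3) 0 i = 0. Proof. by rewrite mxE. Qed.

Definition coordE := (det3E, dot3E, cross0E, cross1E, cross2E, rvDE, rvZE, rvNE, rv0E).

End Vectors.

Ltac vec3 := do ?rewrite !coordE; ring.

Section VectorsTheory.
Context {R : realType}.
Local Notation E3 := 'rV[R]_3.
Implicit Types (a b n u v w x y z : E3).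

Lemma dotC u v : dot u v = dot v u. Proof. vec3. Qed.
Lemma dotDl u v w : dot (u + v) w = dot u w + dot v w. Proof. vec3. Qed.
Lemma dotDr u v w : dot w (u + v) = dot w u + dot w v. Proof. vec3. Qed.
Lemma dotZl (k : R) u v : dot (k *: u) v = k * dot u v. Proof. vec3. Qed.
Lemma dotZr (k : R) u v : dot u (k *: v) = k * dot u v. Proof. vec3. Qed.
Lemma dot0l v : dot 0 v = 0. Proof. vec3. Qed.
Lemma dot0r v : dot v 0 = 0. Proof. vec3. Qed.

Lemma dot_cross1 u v : dot u (cross u v) = 0. Proof. vec3. Qed.
Lemma dot_cross2 u v : dot v (cross u v) = 0. Proof. vec3. Qed.
Lemma dot_cross_cross u v : dot v (cross (cross u v) u) = dot (cross u v) (cross u v).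
Proof. vec3. Qed.
Lemma dot_cross_rot u v w : dot u (cross v w) = dot w (cross u v).
Proof. vec3. Qed.
Lemma det3_cross u v w z :
  det3 (cross u v) w z = dot u w * dot v z - dot u z * dot v w.
Proof. vec3. Qed.
Lemma cross0l v : cross 0 v = 0. Proof. by apply: eq_rv3; vec3. Qed.

Lemma dot_ge0 u : 0 <= dot u u.
Proof. by rewrite dot3E -!expr2 !addr_ge0 // sqr_ge0. Qed.

Lemma dot_eq0 u : dot u u = 0 -> u = 0.
Proof.
rewrite dot3E -!expr2 => h.
have := sqr_ge0 (u 0 0); have := sqr_ge0 (u 0 1); have := sqr_ge0 (u 0 2%:R) => h2 h1 h0.
have z (k : R) : k ^+ 2 = 0 -> k = 0 by move=> /eqP; rewrite sqrf_eq0 => /eqP.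
by apply: eq_rv3; rewrite mxE; apply: z; lra.
Qed.

Lemma dot_neq0 u : u != 0 -> dot u u != 0.
Proof. by apply: contra_neq; exact: dot_eq0. Qed.

Lemma enorm_sqr u : enorm u ^+ 2 = dot u u.
Proof. by rewrite sqr_sqrtr // dot_ge0. Qed.

Lemma exists_orthogonal n : exists2 a : E3, a != 0 & dot a n = 0.
Proof.
pose b : E3 := delta_mx 0 0; pose c : E3 := delta_mx 0 1.
have [nb|nb] := eqVneq (cross n b) 0; last first.
  by exists (cross n b) => //; rewrite dotC dot_cross1.
exists c.
  by apply/eqP => /rowP /(_ 1); rewrite !mxE /= => /eqP; rewrite oner_eq0.
have := cross2E n b; rewrite nb rv0E !mxE /= mulr0 mulr1 sub0r => /esym/eqP.
by rewrite oppr_eq0 => /eqP n1; rewrite dot3E !mxE /= !mul0r mul1r n1 !addr0.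
Qed.

Lemma cross_orthogonal_neq0 a b : a != 0 -> b != 0 -> dot b a = 0 -> cross a b != 0.
Proof.
move=> a0 b0 ba; apply/eqP => ab.
have : dot a a * dot b b = 0.
  transitivity (dot (cross a b) (cross a b) + dot b a ^+ 2); first by vec3.
  by rewrite ab ba dot0l expr0n add0r.
by move/eqP; rewrite mulf_eq0 !(negPf (dot_neq0 _)).
Qed.

End VectorsTheory.

(** * Polynomials in one variable *)

Section Polynomials.
Context {R : realType}.

Lemma poly_eq0_ext (p : {poly R}) : (forall t, p.[t] = 0) -> p = 0.
Proof.
move=> p0; apply/eqP/negPn/negP => pN0.
have := @max_poly_roots R p [seq i%:R | i <- iota 0 (size p)] pN0.
rewrite size_map size_iota ltnn => H; suff : false by [].
apply: H; first by apply/allP => t _; rewrite /root p0.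
by rewrite map_inj_uniq ?iota_uniq // => i j /eqP; rewrite eqr_nat => /eqP.
Qed.

Lemma poly_eq_ext (p q : {poly R}) : (forall t, p.[t] = q.[t]) -> p = q.
Proof.
by move=> pq; apply/eqP; rewrite -subr_eq0; apply/eqP/poly_eq0_ext => t;
  rewrite hornerD hornerN pq subrr.
Qed.

(** Uniqueness for a linear differential equation whose coefficients are
    polynomials: if [u] had a zero of order [j > 0] at [t0], then [b * u'] would
    have one of order [j - 1] there and [c * u] one of order at least [j]. *)
Lemma poly_ode_eq0 (b c u : {poly R}) (t0 : R) :
  b * u^`() = c * u -> b.[t0] != 0 -> u.[t0] = 0 -> u = 0.
Proof.
move=> ode b0 u0; apply/eqP/negPn/negP => uN0.
have [j [w + uE]] := multiplicity_XsubC u t0.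
rewrite uN0 /= => rw.
case: j uE => [|j] uE.
  by move: u0 rw; rewrite uE expr0 mulr1 /root => ->; rewrite eqxx.
have XN0 : ('X - t0%:P) ^+ j != 0 :> {poly R} by rewrite expf_neq0 // polyXsubC_eq0.
have : b * (w *+ j.+1 + ('X - t0%:P) * w^`()) = c * ('X - t0%:P) * w.
  apply: (mulIf XN0); move: ode.
  rewrite uE derivM deriv_exp derivXsubC mul1r /= exprS => ode.
  rewrite -[w *+ _]mulr_natr; rewrite -[_ *+ j.+1]mulr_natr in ode; move: ode.
  move: ('X - t0%:P) (_ ^+ j) (_%:R) (w^`()) => X Xj n w' ode.
  transitivity (b * (w' * (X * Xj) + w * (Xj * n))); first ring.
  by rewrite ode; ring.
move/(congr1 (fun p => p.[t0])); rewrite !hornerE hornerMn subrr !mul0r addr0 mulr0 mul0r.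
move/eqP; rewrite mulf_eq0 (negPf b0) /= mulrn_eq0 /=.
by move: rw; rewrite /root => /negPf ->.
Qed.

Lemma roots_seq (p : {poly R}) : p != 0 -> exists rs : seq R, forall t, root p t -> t \in rs.
Proof.
have [n] := ubnP (size p); elim: n p => // n IH p szp p0.
have [[t pt]|noroot] := pselect (exists t, root p t); last first.
  by exists [::] => t pt; case: noroot; exists t.
have /factor_theorem [q pE] := pt.
have q0 : q != 0 by apply: contra_neq p0 => q0; rewrite pE q0 mul0r.
have [|rs rsP] := IH q _ q0.
  by move: szp; rewrite pE size_Mmonic ?monicXsubC // size_XsubC addnS addn1.
exists (t :: rs) => s; rewrite pE rootM root_XsubC inE => /orP[/rsP ->|/eqP ->].
  by rewrite orbT.
by rewrite eqxx.
Qed.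

End Polynomials.

(** * Smooth homogeneous functions *)

Section Homogeneous.
Context {R : realType}.
Local Notation E3 := 'rV[R]_3.
Implicit Types (u v w x y z : E3) (f : E3 -> R).

Lemma dot_grad f x v : differentiable f x -> dot (grad f x) v = 'D_v f x.
Proof.
move=> df; rewrite deriveE // [in RHS](row_sum_delta v) linear_sum.
by apply: eq_bigr => i _; rewrite mxE linearZ /= -deriveE // mulrC.
Qed.

Definition euler (m : R) f := forall x, dot x (grad f x) = m * f x.

(** Differentiate the Euler relation along the line [x + s *: v], where its left
    side is ['D_x f + s * 'D_v f]. *)
Lemma euler_derive m f v : smooth f -> euler m f -> euler (m - 1) (fun x => 'D_v f x).
Proof.
move=> sf ef x.
have df y : differentiable f y by exact: smooth_differentiable.
have dv w y : differentiable (fun z => 'D_w f z) y.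
  exact/smooth_differentiable/smooth_derive.
rewrite dotC dot_grad // derive_schwarz // mulrBl mul1r.
pose q (s : R) := m * f (x + s *: v).
have qE : q = (fun s => 'D_x f (x + s *: v) + s * 'D_v f (x + s *: v)).
  apply/funext => s; rewrite /q -ef dotC dot_grad // deriveDr // deriveZr //.
have Dq : is_derive (0 : R) 1 q (m * 'D_v f x).
  have := is_derive_line (df (x + (0 : R) *: v)); rewrite scale0r addr0 => h.
  by rewrite /q; apply: is_derive_eq.
have Dq' : is_derive (0 : R) 1 q ('D_v (fun z => 'D_x f z) x + 'D_v f x).
  have := is_derive_line (dv x (x + (0 : R) *: v)); rewrite scale0r addr0 => h.
  have := is_derive_line (dv v (x + (0 : R) *: v)); rewrite scale0r addr0 => h'.
  rewrite qE; apply: is_derive_eq; rewrite scale0r add0r scale0r addr0 /=.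
  by congr (_ + _); rewrite [LHS]mulr1.
have [_ <-] := Dq; have [_ ->] := Dq'; ring.
Qed.

(** The function [t |-> (f (t x) - f 0) ^ 2] vanishes at [0] and, by the Euler
    relation, has a nonpositive derivative for [t > 0]. *)
Lemma euler_le0_const m f x : smooth f -> euler m f -> m <= 0 -> f x = f 0.
Proof.
move=> sf ef m0.
have df y : differentiable f y by exact: smooth_differentiable.
have mf0 : m * f 0 = 0 by rewrite -ef dot0l.
pose g (t : R) := (f (0 + t *: x) - f 0) ^+ 2.
pose g' (t : R) := 2 * (f (0 + t *: x) - f 0) * 'D_x f (0 + t *: x).
have Dg (t : R) : is_derive t 1 g (g' t).
  have h := is_derive_line (df (0 + t *: x)).
  rewrite /g /g'; apply: is_derive_eq.
  rewrite /GRing.scale /=; ring.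
have [||t] := @MVT R g g' 0 1 => //.
  by apply: derivable_within_continuous => t _; have [] := Dg t.
rewrite in_itv /= subr0 mulr1 => /andP[t0 t1] E.
have tg : t * g' t <= 0.
  have -> : t * g' t = 2 * (f (0 + t *: x) - f 0) * (t * 'D_x f (0 + t *: x)).
    by rewrite /g'; ring.
  rewrite -deriveZr // -dot_grad // dotC add0r ef.
  have -> : 2 * (f (t *: x) - f 0) * (m * f (t *: x)) = 
     2 * ((f (t *: x) - f 0) ^+ 2) * m + 2 * (f (t *: x) - f 0) * (m * f 0) by ring.
  by rewrite mf0 mulr0 addr0 mulr_ge0_le0 // mulr_ge0 // sqr_ge0.
have gle : g' t <= 0 by rewrite -(pmulr_rle0 _ t0).
have : g 1 <= 0 by move: E; rewrite {2}/g scale0r addr0 subrr expr0n subr0 /= => ->.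
rewrite /g scale1r add0r => h.
by apply/eqP; rewrite -subr_eq0 -sqrf_eq0 eq_le h sqr_ge0.
Qed.

Definition line_poly f := forall x v, exists p : {poly R}, forall t, f (x + t *: v) = p.[t].

Lemma line_poly_derive f x v (p : {poly R}) : smooth f ->
  (forall t, f (x + t *: v) = p.[t]) ->
  forall t, 'D_v f (x + t *: v) = p^`().[t].
Proof.
move=> sf pE t.
have [_ <-] := is_derive_line (smooth_differentiable (x + t *: v) sf) (v := v).
rewrite (_ : (fun s => _) = horner p); last exact/funext.
by have [_ ->] := is_derive_poly p t.
Qed.

(** Derivatives lower the degree by one, and a degree at most [0] leaves only
    constants; a function of positive degree [m] is recovered from its partial
    derivatives by the Euler relation itself, as [m^-1 * (x, grad f)]. *)
Lemma line_poly_euler m f : smooth f -> euler m f -> line_poly f.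
Proof.
have [N] : exists N : nat, m <= N%:R.
  exists (Num.trunc `|m|).+1; apply: le_trans (ler_norm _) _.
  by apply/ltW; have /andP[] := truncn_itv (normr_ge0 m).
elim: N m f => [|N IH] m f mN sf ef x v.
  by exists (f 0)%:P => t; rewrite hornerC (euler_le0_const _ sf ef).
have [m0|m0] := leP m 0.
  by exists (f 0)%:P => t; rewrite hornerC (euler_le0_const _ sf ef).
have P i : exists p : {poly R}, forall t, grad f (x + t *: v) 0 i = p.[t].
  have mN' : m - 1 <= N%:R by rewrite lerBlDr -natr1 in mN *.
  have [p pE] := IH _ _ mN' (smooth_derive (delta_mx 0 i) sf) (euler_derive (delta_mx 0 i) sf ef) x v.
  by exists p => t; rewrite mxE pE.
have [p0 E0] := P 0; have [p1 E1] := P 1; have [p2 E2] := P 2%:R.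
exists (m^-1 *: (((x 0 0)%:P + v 0 0 *: 'X) * p0 + ((x 0 1)%:P + v 0 1 *: 'X) * p1 +
   ((x 0 2%:R)%:P + v 0 2%:R *: 'X) * p2)) => t.
have co i : (x + t *: v) 0 i = x 0 i + t * v 0 i by rewrite !mxE.
apply: (mulfI (lt0r_neq0 m0)); rewrite -ef dot3E !co E0 E1 E2.
by rewrite hornerZ mulrA mulfV ?lt0r_neq0 // mul1r !hornerE !(mulrC t).
Qed.

(** On the line through [0] and [x] the Euler relation is the equation
    [t p' = m p], whose leading coefficient is nonzero at [t = 1]. *)
Lemma euler_scale_eq0 m f x (a : R) : smooth f -> euler m f -> f x = 0 -> f (a *: x) = 0.
Proof.
move=> sf ef fx.
have [p pE] := line_poly_euler sf ef 0 x.
have dp := line_poly_derive sf pE.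
suff -> : f (a *: x) = p.[a].
  suff -> : p = 0 by rewrite horner0.
  apply: (@poly_ode_eq0 _ 'X m%:P _ 1).
  - apply: poly_eq_ext => t; rewrite !hornerE -dp -pE add0r.
    by rewrite -deriveZr -?dot_grad 1?dotC //; exact: smooth_differentiable.
  - by rewrite hornerX oner_neq0.
  - by rewrite -pE scale1r add0r.
by rewrite -pE add0r.
Qed.

End Homogeneous.

(** * Derivatives along the level curves on a sphere *)

Section LevelCurves.
Context {R : realType}.

Lemma small_slope (A B : R) : A != 0 ->
  exists e, [/\ 0 < e, e <= 1 & e * `|B| <= `|A| / 2].
Proof.
move=> A0.
have nA : 0 < `|A| by rewrite normr_gt0.
pose e := Num.min 1 (`|A| / (2 * (`|B| + 1))).
have den : 0 < 2 * (`|B| + 1) by rewrite mulr_gt0 // ltr_wpDl.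
have e0 : 0 < e by rewrite lt_min ltr01 divr_gt0.
exists e; split => //; first by rewrite ge_min lexx.
have : e * (2 * (`|B| + 1)) <= `|A|.
  by rewrite -ler_pdivlMr // ge_min lexx orbT.
have : e * `|B| <= e * (`|B| + 1) by rewrite ler_pM2l // lerDl.
lra.
Qed.

(** The level set of [h] through [0] is tangent to the first axis.  For each
    slope [e > 0] the intermediate value theorem finds a point of it in the cone
    of slope [e] around that axis, arbitrarily near [0]; there [k] takes the value
    [k 0], which bounds ['D_(1, 0) k 0] by a multiple of [e]. *)
Lemma derive_along_level (h k : R * R -> R) : continuous h ->
  differentiable h 0 -> differentiable k 0 ->
  'D_(1, 0) h 0 = 0 -> 0 < 'D_(0, 1) h 0 ->
  (forall z, h z = h 0 -> k z = k 0) -> 'D_(1, 0) k 0 = 0.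
Proof.
move=> ch dh dk h1 h2 lev.
have dec g (a b : R) : differentiable g (0 : R * R) ->
    'D_(a, b) g 0 = a * 'D_(1, 0) g 0 + b * 'D_(0, 1) g 0.
  have -> : (a, b) = a *: (1, 0) + b *: (0, 1) :> R * R.
    apply: injective_projections.
      by rewrite -[RHS]/(a * 1 + b * 0) mulr1 mulr0 addr0.
    by rewrite -[RHS]/(a * 0 + b * 1) mulr1 mulr0 add0r.
  by move=> dg; rewrite (deriveDr _ _ dg) !(deriveZr _ _ dg).
apply/eqP/negPn/negP => A0.
set A := 'D_(1, 0) k 0 in A0; pose B := 'D_(0, 1) k 0; set b := 'D_(0, 1) h 0 in h2.
have [e [e0 e1 eB]] := small_slope B A0.
have nA : 0 < `|A| by rewrite normr_gt0.
have nB : 0 <= `|B| := normr_ge0 B.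
(* With the error at most [b e / 2] times the norm, the sign of [h - h 0] at
   [(t, +- e t)] is the one of [+- b e t]; the error for [k] is small against
   [`|A| - e `|B|], which is at least [`|A| / 2]. *)
have [|d1 d10 H1] := @differentiable_bound _ _ h 0 (b * e / 2) dh.
  by rewrite divr_gt0 // mulr_gt0.
have [|d2 d20 H2] := @differentiable_bound _ _ k 0 (`|A| / 4) dk.
  by rewrite divr_gt0.
pose t := Num.min d1 d2 / 2.
have d0 : 0 < Num.min d1 d2 by rewrite lt_min d10.
have t0 : 0 < t by rewrite divr_gt0.
have [td1 td2] : t < d1 /\ t < d2.
  have : t < Num.min d1 d2 by rewrite ltr_pdivrMr // ltr_pMr // ltr1n.
  by rewrite lt_min => /andP[].
have et0 : 0 < e * t by rewrite mulr_gt0.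
have nz (v : R) : `|v| <= e * t -> `|(t, v)| = t.
  move=> vt; rewrite prod_normE /= gtr0_norm //; apply/max_idPl.
  by apply: le_trans vt _; rewrite ler_piMl // ltW.
have Hh (v : R) : `|v| <= e * t -> `|h (t, v) - h 0 - v * b| <= b * e / 2 * t.
  move=> vt; have := H1 (t, v); rewrite nz // => /(_ td1).
  by rewrite dec // h1 mulr0 add0r addr0.
have Hk (v : R) : `|v| <= e * t -> `|k (t, v) - k 0 - (t * A + v * B)| <= `|A| / 4 * t.
  move=> vt; have := H2 (t, v); rewrite nz // => /(_ td2).
  by rewrite dec // addr0.
clearbody t A B b; clear dh dk h1 dec H1 H2.
have bet : 0 < b * e * t by rewrite mulr_gt0 // mulr_gt0.
have up : h 0 <= h (t, e * t).
  have := Hh (e * t); rewrite gtr0_norm // lexx => /(_ isT).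
  by rewrite ler_norml => /andP[+ _]; lra.
have dn : h (t, - (e * t)) <= h 0.
  have := Hh (- (e * t)); rewrite normrN gtr0_norm // lexx => /(_ isT).
  by rewrite ler_norml => /andP[_]; lra.
have [|||v vI hv] := @IVT R (fun v => h (t, v)) (- (e * t)) (e * t) (h 0).
- lra.
- apply: continuous_subspaceT => v.
  apply: (@continuous_comp _ _ _ (fun v : R => (t, v)) h); last exact: ch.
  by apply/differentiable_continuous/differentiable_pair.
- by rewrite ge_min dn le_max up orbT.
have nv : `|v| <= e * t by rewrite ler_norml; move: vI; rewrite in_itv.
have := Hk v nv; rewrite lev // subrr sub0r normrN.
apply/negP; rewrite -ltNge.
have h3 : `|t * A| = t * `|A| by rewrite normrM gtr0_norm.
have h4 : `|v * B| <= t * (`|A| / 2).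
  rewrite normrM; apply: le_trans (ler_wpM2r nB nv) _.
  by rewrite mulrAC mulrC ler_pM2l.
have h5 : `|t * A| <= `|t * A + v * B| + `|v * B|.
  by rewrite -{1}(addrK (v * B) (t * A)); exact: ler_normB.
have : 0 < t * `|A| by rewrite mulr_gt0.
lra.
Qed.

End LevelCurves.

Section Sphere.
Context {R : realType}.
Local Notation E3 := 'rV[R]_3.
Implicit Types (u v w x y : E3) (f : E3 -> R).

(** A normal vector of the plane through [0] spanned by the position and the
    gradient, which on a surface of revolution is the meridian plane of [x]. *)
Definition meridian_normal f x : E3 := cross x (grad f x).

(** Stereographic projection: it keeps to the sphere of radius [|x|] exactly and
    is a rational map. *)
Lemma sphere_chart x u v : x != 0 -> dot x u = 0 -> dot x v = 0 -> dot u v = 0 ->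
  exists S : R * R -> E3, [/\ S 0 = x, forall z, differentiable S z,
    forall z, dot (S z) (S z) = dot x x,
    'D_(1, 0) S 0 = 2 *: u & 'D_(0, 1) S 0 = 2 *: v].
Proof.
move=> x0 xu xv uv.
pose rho (z : R * R) : R := (z.1 * z.1 * dot u u + z.2 * z.2 * dot v v) / dot x x.
pose phi (z : R * R) : R := 2 * (1 + rho z)^-1.
have xx0 : dot x x != 0 by exact: dot_neq0.
have rho_ge0 z : 0 <= rho z.
  by rewrite /rho -!expr2 divr_ge0 ?dot_ge0 // addr_ge0 // mulr_ge0 ?dot_ge0 ?sqr_ge0.
have rho1 z : 1 + rho z != 0 by rewrite lt0r_neq0 // ltr_pwDl.
have d1 (z : R * R) : differentiable (fun z : R * R => z.1) z.
  apply: (@linear_differentiable _ _ _ (fst : {linear (R * R)%type -> R})) => y; exact: cvg_fst.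
have d2 (z : R * R) : differentiable (fun z : R * R => z.2) z.
  apply: (@linear_differentiable _ _ _ (snd : {linear (R * R)%type -> R})) => y; exact: cvg_snd.
have dM (g1 g2 : R * R -> R) z : differentiable g1 z -> differentiable g2 z ->
    differentiable (fun z => g1 z * g2 z) z by move=> ? ?; exact: differentiableM.
pose n (z : R * R) : R := z.1 * z.1 * dot u u + z.2 * z.2 * dot v v.
have dn z : differentiable n z.
  apply: differentiableD; apply: (dM _ (cst _)) => //; exact: dM.
have drho z : differentiable rho z by apply: (dM n (cst _)).
have dphi z : differentiable phi z.
  apply: differentiableM; first exact: differentiable_cst.
  apply: differentiableV => //; apply: differentiableD => //.
have phiE (z : R * R) : phi z * (1 + rho z) = 2 by rewrite /phi mulfVK.
have rhoE (z : R * R) : z.1 ^+ 2 * dot u u + z.2 ^+ 2 * dot v v = rho z * dot x x.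
  by rewrite /rho -!expr2 mulfVK.
have rho0 : rho 0 = 0 by rewrite /rho /= !mul0r addr0 mul0r.
have phi0 : phi 0 = 2 by rewrite /phi rho0 addr0 invr1 mulr1.
have DM (g1 g2 : R * R -> R) (w : R * R) : differentiable g1 0 -> differentiable g2 0 -> g2 0 = 0 ->
    'D_w (fun z => g1 z * g2 z) 0 = g1 0 * 'D_w g2 0.
  move=> h1 h2 g20; rewrite (deriveM (f := g1) (g := g2)); try exact: diff_derivable.
  by rewrite g20 scale0r addr0.
have D1 (w : R * R) : 'D_w (fun z : R * R => z.1) 0 = w.1.
  rewrite deriveE // (diff_lin (f := (fst : {linear (R * R)%type -> R}))) //.
  by move=> y; exact: cvg_fst.
have D2 (w : R * R) : 'D_w (fun z : R * R => z.2) 0 = w.2.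
  rewrite deriveE // (diff_lin (f := (snd : {linear (R * R)%type -> R}))) //.
  by move=> y; exact: cvg_snd.
have Dsq (g : R * R -> R) (a : R) (w : R * R) : differentiable g 0 -> g 0 = 0 ->
    'D_w (fun z => g z * g z * a) 0 = 0.
  move=> dg g0; rewrite (deriveMr _ (diff_derivable (dM _ _ _ dg dg))).
  by rewrite DM // g0 mul0r mulr0.
have Drho (w : R * R) : 'D_w rho 0 = 0.
  rewrite (deriveMr (f := n) _ (diff_derivable (dn 0))).
  rewrite /n deriveD.
  - by rewrite (Dsq _ _ _ (d1 0)) // (Dsq _ _ _ (d2 0)) // addr0 mulr0.
  - exact/diff_derivable/(dM _ (cst _) _ (dM _ _ _ (d1 0) (d1 0))).
  - exact/diff_derivable/(dM _ (cst _) _ (dM _ _ _ (d2 0) (d2 0))).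
(* With [w = z.1 u + z.2 v] and [rho = |w|^2 / |x|^2], the point
   [((1 - rho) x + 2 w) / (1 + rho)] of the sphere, written as [x + phi w - phi rho x]. *)
pose S (z : R * R) := x + ((phi z * z.1) *: u + (phi z * z.2) *: v + (- (phi z * rho z)) *: x).
have dZ (g : R * R -> R) (y : E3) z : differentiable g z -> differentiable (fun z => g z *: y) z.
  exact: differentiableZl.
have DS (w : R * R) : 'D_w S 0 = (2 * w.1) *: u + (2 * w.2) *: v.
  have e1 := dM _ _ _ (dphi 0) (d1 0); have e2 := dM _ _ _ (dphi 0) (d2 0).
  have e3 := dM _ _ _ (dphi 0) (drho 0).
  have e3' : differentiable (fun z => - (phi z * rho z)) 0 by exact: differentiableN.
  have f1 := dZ _ u _ e1; have f2 := dZ _ v _ e2; have f3 := dZ _ x _ e3'.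
  have f12 : differentiable (fun z : R * R => (phi z * z.1) *: u + (phi z * z.2) *: v) 0.
    exact: differentiableD.
  have f123 : differentiable (fun z : R * R => (phi z * z.1) *: u + (phi z * z.2) *: v
      + (- (phi z * rho z)) *: x) 0 by exact: differentiableD.
  rewrite /S (deriveD (diff_derivable (differentiable_cst x _)) (diff_derivable f123)).
  rewrite (deriveD (diff_derivable f12) (diff_derivable f3)).
  rewrite (deriveD (diff_derivable f1) (diff_derivable f2)) derive_cst add0r.
  rewrite (deriveZl _ _ e1) (deriveZl _ _ e2) (deriveZl _ _ e3').
  rewrite (deriveN (diff_derivable e3)) (DM _ _ _ (dphi 0) (d1 0)) //.
  rewrite (DM _ _ _ (dphi 0) (d2 0)) // (DM _ _ _ (dphi 0) (drho 0)) //.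
  by rewrite D1 D2 Drho phi0 mulr0 oppr0 scale0r addr0.
exists S; split.
- by rewrite /S rho0 /= !mulr0 oppr0 !scale0r !addr0.
- move=> z; apply: differentiableD; first exact: differentiable_cst.
  apply: differentiableD; first apply: differentiableD; apply: dZ; try exact: dM.
  by apply: differentiableN; exact: dM.
- move=> z; rewrite /S; move: (phiE z) (rhoE z).
  move: (phi z) (rho z) => p r pE rE.
  transitivity ((1 - p * r) ^+ 2 * dot x x +
      p ^+ 2 * (z.1 ^+ 2 * dot u u + z.2 ^+ 2 * dot v v) +
      2 * (1 - p * r) * p * z.1 * dot x u + 2 * (1 - p * r) * p * z.2 * dot x v +
      2 * p * z.1 * (p * z.2) * dot u v); first by vec3.
  rewrite xu xv uv !mulr0 !addr0 rE.
  transitivity ((1 + p * r * (p * (1 + r) - 2)) * dot x x); first by ring.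
  by rewrite pE subrr mulr0 addr0 mul1r.
- by rewrite DS /= mulr1 mulr0 scale0r addr0.
- by rewrite DS /= mulr1 mulr0 scale0r add0r.
Qed.

End Sphere.

Section LevelSetsOfGradient.
Context {R : realType}.
Local Notation E3 := 'rV[R]_3.
Implicit Types (u v w x y : E3) (f : E3 -> R).

(** The Hessian matrix of [f] at [x] applied to [v]: by the symmetry of second
    derivatives, the gradient of ['D_v f] is the derivative of [grad f] along [v]. *)
Definition hess f x v : E3 := grad (fun y => 'D_v f y) x.

Lemma dot_hess f x v w : smooth f -> dot (hess f x v) w = 'D_w (fun y => 'D_v f y) x.
Proof. by move=> sf; rewrite dot_grad //; exact/smooth_differentiable/smooth_derive. Qed.

Lemma hess_sym f x v w : smooth f -> dot (hess f x v) w = dot (hess f x w) v.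
Proof.
move=> sf; apply: etrans (dot_hess x v w sf) _.
exact: etrans (derive_schwarz x w v sf) (esym (dot_hess x w v sf)).
Qed.

Lemma hess_coord f x v i : smooth f ->
  hess f x v 0 i = 'D_v (fun y => grad f y 0 i) x.
Proof.
move=> sf; rewrite mxE (derive_schwarz _ _ _ sf).
by congr ('D_v _ x); apply/funext => y; rewrite mxE.
Qed.

Lemma differentiable_grad f x i : smooth f -> differentiable (fun y => grad f y 0 i) x.
Proof.
move=> sf; rewrite (_ : (fun _ => _) = fun y => 'D_(delta_mx 0 i) f y).
  exact/smooth_differentiable/smooth_derive.
by apply/funext => y; rewrite mxE.
Qed.

(** Let [n = cross x (grad f x)].  In the chart of the sphere through [x] with directions
    [n] and [cross n x], the derivative of [f] is zero along [n] and positive along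
    [cross n x], and the squared length [P] of the gradient is constant on the level
    sets of [f].  Hence [P] has a zero derivative along [n], which by symmetry of
    the Hessian is twice the determinant of the statement. *)
Lemma hess_in_plane f x : smooth f ->
  (exists g : R -> R -> R, forall y, enorm (grad f y) ^+ 2 = g (f y) (enorm y)) ->
  det3 x (grad f x) (hess f x (grad f x)) = 0.
Proof.
move=> sf [g gE].
have df y : differentiable f y by exact: smooth_differentiable.
have [W0|Wn0] := eqVneq (meridian_normal f x) 0; first by rewrite /det3 -/(meridian_normal f x) W0 dot0l.
have x0 : x != 0.
  apply: contra_neq Wn0 => ->; exact: cross0l.
set p := grad f x; set n := meridian_normal f x.
have [|||S [S0 dS rS S1 S2]] := @sphere_chart R x n (cross n x) x0.
- exact: dot_cross1.
- exact: dot_cross2.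
- exact: dot_cross1.
pose P y := dot (grad f y) (grad f y).
have PE y : P y = g (f y) (enorm y) by rewrite -gE enorm_sqr.
have dg2 i : differentiable (fun y => grad f y 0 i * grad f y 0 i) x.
  by apply: differentiableM; exact: differentiable_grad.
have PE3 : P = fun y => grad f y 0 0 * grad f y 0 0 + grad f y 0 1 * grad f y 0 1 +
     grad f y 0 2%:R * grad f y 0 2%:R.
  by apply/funext => y; rewrite /P dot3E.
have dP01 : differentiable (fun y => grad f y 0 0 * grad f y 0 0 + grad f y 0 1 * grad f y 0 1) x.
  by apply: differentiableD.
have dP : differentiable P x by rewrite PE3; apply: differentiableD.
have DP : 'D_n P x = 2 * dot p (hess f x n).
  have Di i : 'D_n (fun y => grad f y 0 i * grad f y 0 i) x = 2 * (p 0 i * hess f x n 0 i).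
    have dd := diff_derivable (v := n) (differentiable_grad x i sf).
    by rewrite (deriveM dd dd) -hess_coord // -mulr2n mulr_natl.
  rewrite PE3 (deriveD (diff_derivable dP01) (diff_derivable (dg2 _))).
  rewrite (deriveD (diff_derivable (dg2 _)) (diff_derivable (dg2 _))).
  by rewrite !Di -!mulrDr -dot3E.
have dfS z : differentiable (fun z => f (S z)) z.
  exact: (differentiable_comp (dS z) (df _)).
have /eqP : 'D_(1, 0) (fun z => P (S z)) 0 = 0.
  apply: (@derive_along_level _ (fun z => f (S z))) => //.
  - by move=> z; exact: differentiable_continuous.
  - by apply: (differentiable_comp (dS 0)); rewrite S0.
  - rewrite (derive_comp _ (dS 0) (df _)) S1 S0 deriveZr //.
    by rewrite -dot_grad // dot_cross2 mulr0.
  - rewrite (derive_comp _ (dS 0) (df _)) S2 S0 deriveZr // -dot_grad // mulr_gt0 //.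
    suff -> : dot (grad f x) (cross n x) = dot n n.
      by rewrite lt0r dot_neq0 // dot_ge0.
    exact: dot_cross_cross.
  - move=> z hz; rewrite !PE hz; congr (g _ _).
    by rewrite /enorm !rS.
rewrite derive_comp // S0 // S1 deriveZr // DP !mulf_eq0 pnatr_eq0 /= => /eqP.
by rewrite dotC hess_sym // dotC.
Qed.

End LevelSetsOfGradient.

(** * Planes invariant under the gradient *)

Section PolynomialFunctions.
Context {R : realType}.
Local Notation E3 := 'rV[R]_3.
Implicit Types (F G : R -> R) (u v w : R -> E3).

Definition poly_fun F := exists p : {poly R}, forall t, F t = p.[t].

Definition poly_curve u := forall i, poly_fun (fun t => u t 0 i).

Lemma poly_fun_cst a : poly_fun (fun _ => a).
Proof. by exists a%:P => t; rewrite hornerC. Qed.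

Lemma poly_funD F G : poly_fun F -> poly_fun G -> poly_fun (fun t => F t + G t).
Proof. by move=> [p pE] [q qE]; exists (p + q) => t; rewrite hornerD pE qE. Qed.

Lemma poly_funN F : poly_fun F -> poly_fun (fun t => - F t).
Proof. by move=> [p pE]; exists (- p) => t; rewrite hornerN pE. Qed.

Lemma poly_funM F G : poly_fun F -> poly_fun G -> poly_fun (fun t => F t * G t).
Proof. by move=> [p pE] [q qE]; exists (p * q) => t; rewrite hornerM pE qE. Qed.

Lemma poly_curve_cst (a : E3) : poly_curve (fun _ => a).
Proof. by move=> i; exact: poly_fun_cst. Qed.

Lemma poly_curve_line (x v : E3) : poly_curve (fun t => x + t *: v).
Proof.
move=> i; exists ((x 0 i)%:P + v 0 i *: 'X) => t.
by rewrite !mxE !hornerE mulrC.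
Qed.

Lemma poly_fun_dot u v : poly_curve u -> poly_curve v -> poly_fun (fun t => dot (u t) (v t)).
Proof.
move=> pu pv; rewrite (_ : (fun _ => _) = fun t => u t 0 0 * v t 0 0 + u t 0 1 * v t 0 1
   + u t 0 2%:R * v t 0 2%:R); last by apply/funext => t; rewrite dot3E.
by apply: poly_funD; first apply: poly_funD; apply: poly_funM.
Qed.

Lemma poly_curve_cross u v : poly_curve u -> poly_curve v ->
  poly_curve (fun t => cross (u t) (v t)).
Proof.
move=> pu pv; have h i j : poly_fun (fun t => u t 0 i * v t 0 j - u t 0 j * v t 0 i).
  by apply: poly_funD; [|apply: poly_funN]; apply: poly_funM.
move=> i; rewrite (_ : (fun _ => _) = fun t => 
  if i == 0 then u t 0 1 * v t 0 2%:R - u t 0 2%:R * v t 0 1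
   else if i == 1 then u t 0 2%:R * v t 0 0 - u t 0 0 * v t 0 2%:R
   else u t 0 0 * v t 0 1 - u t 0 1 * v t 0 0); last by apply/funext => t; rewrite mxE.
by case: eqP => _; [|case: eqP => _]; exact: h.
Qed.

Lemma poly_fun_det3 u v w : poly_curve u -> poly_curve v -> poly_curve w ->
  poly_fun (fun t => det3 (u t) (v t) (w t)).
Proof. by move=> pu pv pw; apply: poly_fun_dot => //; exact: poly_curve_cross. Qed.

Lemma cross_frame (y e p : E3) (n := cross y e) :
  dot n n *: p = det3 p e n *: y + det3 y p n *: e + dot n p *: n.
Proof. by rewrite /n; apply: eq_rv3; vec3. Qed.

Lemma double_cross (a b c : E3) : cross (cross a b) c = dot a c *: b - dot b c *: a.
Proof. by apply: eq_rv3; vec3. Qed.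

(** The algebra behind [normal_ode]: [p], [h] and [q] stand for the gradient, for
    its derivative along [e] and for the Hessian applied to [cross y p].  Expanding
    [p] in the frame [y], [e], [n] turns [(q, p) = 0] into an equation for [(n, p)]. *)
Lemma frame_ode (y e p h r q : E3) (n := cross y e) :
  dot q y = 0 -> dot q e = det3 y p h -> dot q n = det3 y p r -> dot q p = 0 ->
  det3 y p n * (det3 y p n * dot n h) =
  - (det3 y p n * det3 y n h + dot n n * det3 y p r) * dot n p.
Proof.
move=> qy qe qn qp; set b := det3 y p n.
have H1 : b * det3 y p h + dot n p * det3 y p r = 0.
  have := congr1 (dot q) (cross_frame y e p).
  by rewrite !dotDr !dotZr qy qe qn qp !mulr0 add0r => <-.
have H2 : dot n n * det3 y p h = b * dot n h + dot n p * det3 y n h.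
  transitivity (det3 y (dot n n *: p) h); first by vec3.
  by rewrite /n cross_frame -/n -/b /det3; vec3.
have -> : b * (b * dot n h) = b * (b * dot n h + dot n p * det3 y n h)
  - b * (dot n p * det3 y n h) by ring.
rewrite -H2.
transitivity (dot n n * (b * det3 y p h + dot n p * det3 y p r)
  - (b * det3 y n h + dot n n * det3 y p r) * dot n p); first by ring.
by rewrite H1 mulr0 add0r mulNr.
Qed.

End PolynomialFunctions.

Section NormalPlanes.
Context {R : realType}.
Local Notation E3 := 'rV[R]_3.
Context (f : E3 -> R) (m : R) (sf : smooth f) (ef : euler m f)
  (hpl : forall x, det3 x (grad f x) (hess f x (grad f x)) = 0).
Implicit Types (x y e n : E3).

Lemma grad_poly_curve x v : poly_curve (fun t => grad f (x + t *: v)).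
Proof.
move=> i.
have [p pE] := line_poly_euler (smooth_derive (delta_mx 0 i) sf) (euler_derive (delta_mx 0 i) sf ef) x v.
by exists p => t; rewrite mxE pE.
Qed.

Lemma hess_poly_curve x v n : poly_curve (fun t => hess f (x + t *: v) n).
Proof.
move=> i.
have s1 := smooth_derive n sf; have e1 := euler_derive n sf ef.
have [p pE] := line_poly_euler (smooth_derive (delta_mx 0 i) s1) (euler_derive (delta_mx 0 i) s1 e1) x v.
by exists p => t; rewrite mxE pE.
Qed.

Lemma hess_radial y w : dot (hess f y w) y = (m - 1) * dot (grad f y) w.
Proof.
rewrite dotC (euler_derive w sf ef) dot_grad //; exact: smooth_differentiable.
Qed.

(** On a line [y = x + t e] the normal [n = cross y e] is constant, so the factor
    [(n, hess f y e)] on the left is the derivative of [(n, grad f y)]: this is a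
    linear homogeneous differential equation for [(n, grad f y)]. *)
Lemma normal_ode y e (p := grad f y) (n := cross y e) :
  det3 y p n * (det3 y p n * dot n (hess f y e)) =
  - (det3 y p n * det3 y n (hess f y e) + dot n n * det3 y p (hess f y n)) * dot n p.
Proof.
apply: (@frame_ode _ y e p _ _ (hess f y (cross y p))).
- by rewrite hess_radial dot_cross2 mulr0.
- exact: etrans (hess_sym y (cross y p) e sf) (dotC _ _).
- exact: etrans (hess_sym y (cross y p) n sf) (dotC _ _).
- apply: etrans (hess_sym y (cross y p) p sf) _.
  by apply: etrans (dotC _ _) (hpl y).
Qed.

(** The function [(n, grad f)] vanishes at [x] and satisfies [normal_ode] on the
    line through [x] in the direction of the gradient; its leading
    coefficient at [x] is the square of [(n, n)]. *)
Lemma normal_line x t (n := meridian_normal f x) : dot n (grad f (x + t *: grad f x)) = 0.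
Proof.
have [n0|n0] := eqVneq n 0; first by rewrite n0 dot0l.
set e := grad f x; pose y t := x + t *: e.
have cy s : cross (y s) e = n by rewrite /y /n /meridian_normal -/e; apply: eq_rv3; vec3.
have pn : poly_curve (fun=> n) := poly_curve_cst n.
have py : poly_curve y := poly_curve_line x e.
have pp : poly_curve (fun s => grad f (y s)) := grad_poly_curve x e.
have ph : poly_curve (fun s => hess f (y s) e) := hess_poly_curve x e e.
have pr : poly_curve (fun s => hess f (y s) n) := hess_poly_curve x e n.
have [u uE] := poly_fun_dot pn pp.
have [b bE] := poly_fun_det3 py pp pn.
have [c cE] : poly_fun (fun s => - (det3 (y s) (grad f (y s)) n * det3 (y s) n (hess f (y s) e) +
   dot n n * det3 (y s) (grad f (y s)) (hess f (y s) n))).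
  apply: poly_funN; apply: poly_funD; apply: poly_funM; try exact: poly_fun_det3.
  exact: poly_fun_cst.
have uE' s : 'D_n f (x + s *: e) = u.[s].
  by rewrite -uE /= dotC dot_grad //; exact: smooth_differentiable.
have duE s : u^`().[s] = dot n (hess f (y s) e).
  rewrite -(line_poly_derive (smooth_derive n sf) uE') -(dot_hess _ _ _ sf).
  by rewrite (hess_sym _ _ _ sf) dotC.
suff u0 : u = 0 by rewrite uE u0 horner0.
apply: (@poly_ode_eq0 _ (b * b) c _ 0).
- apply: poly_eq_ext => s; rewrite !hornerM -bE -cE -uE duE -mulrA.
  by have := normal_ode (y s) e; rewrite /= cy.
- have y0 : y 0 = x by rewrite /y scale0r addr0.
  by rewrite hornerM -bE y0 -/e /det3 -/(meridian_normal f x) -/n mulf_neq0 // dot_neq0.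
- rewrite -uE /y scale0r addr0; exact: etrans (dotC _ _) (dot_cross2 _ _).
Qed.

(** The lines through [0] and the points of [normal_line] fill the plane
    orthogonal to the normal, except for the direction of [grad f x]. *)
Lemma normal_plane x y : dot (meridian_normal f x) y = 0 -> dot (meridian_normal f x) (grad f y) = 0.
Proof.
set n := meridian_normal f x => ny.
have [n0|n0] := eqVneq n 0; first by rewrite n0 dot0l.
set e := grad f x.
have sn := smooth_derive n sf; have en := euler_derive n sf ef.
have DnE z : dot n (grad f z) = 'D_n f z.
  by rewrite dotC dot_grad //; exact: smooth_differentiable.
have nn0 := dot_neq0 n0.
pose a := (dot n n)^-1 * det3 y e n; pose b := (dot n n)^-1 * det3 x y n.
have yE : y = b *: e + a *: x.
  have /= := cross_frame x e y; rewrite (_ : cross x e = n) // ny scale0r addr0 => E.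
  by rewrite /a /b -!scalerA [RHS]addrC -scalerDr -E scalerA mulVf // scale1r.
rewrite DnE yE.
have nz s : s != 0 -> 'D_n f (b *: e + s *: x) = 0.
  move=> s0; have -> : b *: e + s *: x = s *: (x + (b / s) *: e).
    by rewrite scalerDr scalerA mulrC divfK // addrC.
  by apply: (euler_scale_eq0 _ sn en); rewrite -DnE normal_line.
have [p pE] := line_poly_euler sn en (b *: e) x.
suff p0 : p = 0 by rewrite pE p0 horner0.
(* The points [b *: e + s *: x] with [s != 0] are multiples of points of
   [normal_line]; at [s = 0] the polynomial [p] vanishes by continuity. *)
suff /eqP : 'X * p = 0 by rewrite mulf_eq0 polyX_eq0 /= => /eqP.
apply: poly_eq0_ext => s; rewrite hornerM hornerX -pE.
by have [->|/nz->] := eqVneq s 0; rewrite ?mul0r ?mulr0.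
Qed.

(** On the line where two of the planes meet, the gradient is orthogonal to both
    normals, so it is radial. *)
Lemma meridian_normal_cross x1 x2 : meridian_normal f (cross (meridian_normal f x1) (meridian_normal f x2)) = 0.
Proof.
rewrite /meridian_normal double_cross -/(meridian_normal f x1) -/(meridian_normal f x2) !normal_plane.
- by rewrite !scale0r subr0.
- exact: dot_cross2.
- exact: dot_cross1.
Qed.

End NormalPlanes.

(** * Existence of an axis *)

Section Axis.
Context {R : realType}.
Local Notation E3 := 'rV[R]_3.

Context (f : E3 -> R) (m : R) (sf : smooth f) (ef : euler m f)
  (hpl : forall x, det3 x (grad f x) (hess f x (grad f x)) = 0).
Implicit Types (x y e n : E3).

Lemma meridian_normal_poly_curve x v : poly_curve (fun t => meridian_normal f (x + t *: v)).
Proof.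
exact: poly_curve_cross (poly_curve_line x v) (grad_poly_curve sf ef x v).
Qed.

(** A coordinate of the normal at [t *: x] is [t] times a derivative of [f] at
    [t *: x], in a direction that depends on [x] only; [euler_scale_eq0] applies to
    that derivative. *)
Lemma meridian_normal_scale_eq0 (a : R) x : a != 0 -> meridian_normal f (a *: x) = 0 -> meridian_normal f x = 0.
Proof.
move=> a0 Wax; apply: dot_eq0; set n := {1}(meridian_normal f x).
pose z := cross n x.
have Wz y w : dot n (cross w (grad f y)) = 'D_(cross n w) f y.
  rewrite -dot_grad; first exact: dot_cross_rot.
  exact: smooth_differentiable.
rewrite /meridian_normal Wz -/z -[x in 'D_z f x](scalerK a0).
apply: (euler_scale_eq0 _ (smooth_derive z sf) (euler_derive z sf ef)).
apply: (mulfI a0); rewrite mulr0 -deriveZr; last exact: smooth_differentiable.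
have -> : a *: z = cross n (a *: x) by apply: eq_rv3; rewrite /z; vec3.
by rewrite -Wz -/(meridian_normal f (a *: x)) Wax dot0r.
Qed.

(** Let [n = meridian_normal f x1] and [e = grad f x1].  The plane of [x'']
    meets the plane orthogonal to [n] along the line spanned by
    [cross n N = A x1 + B e], with [N] the normal at [x''].  By
    [meridian_normal_cross], either [A = 0] or [B / A] is one of the finitely many
    zeros of a nonzero polynomial [w].  When [x''] runs through the line from [x]
    to [x'], [A] and [B] are polynomials, so a single one of these alternatives
    holds identically: the two ends give the same line. *)
Lemma normals_coplanar x1 x x' : det3 (meridian_normal f x1) (meridian_normal f x) (meridian_normal f x') = 0.
Proof.
set n := meridian_normal f x1; have [n0|n0] := eqVneq n 0.
  by rewrite n0 /det3 cross0l dot0l.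
set e := grad f x1; pose N s := meridian_normal f (x + s *: (x' - x)).
have pN : poly_curve N := meridian_normal_poly_curve x (x' - x).
have [A AE] := poly_funN (poly_fun_dot (poly_curve_cst e) pN).
have [B BE] := poly_fun_dot (poly_curve_cst x1) pN.
have [w wE] := poly_fun_dot (poly_curve_cst n) (meridian_normal_poly_curve x1 e).
have w0 : w != 0.
  apply/eqP => w0; have := wE 0; rewrite w0 horner0 scale0r addr0.
  by apply/eqP; exact: dot_neq0.
have [rs rsP] := roots_seq w0.
have crit s : A.[s] != 0 -> B.[s] / A.[s] \in rs.
  move=> As; apply: rsP; rewrite /root -wE.
  rewrite (@meridian_normal_scale_eq0 A.[s]) ?dot0r // scalerDr scalerA mulrC divfK // -AE -BE.
  have -> : - dot e (N s) *: x1 + dot x1 (N s) *: e = cross n (N s).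
    by rewrite double_cross scaleNr addrC.
  exact: meridian_normal_cross.
(* A product of polynomials vanishes identically only if one factor does. *)
have : A * \prod_(r <- rs) (B - r *: A) = 0.
  apply: poly_eq0_ext => s; rewrite hornerM horner_prod.
  have [->|As] := eqVneq A.[s] 0; first by rewrite mul0r.
  rewrite (big_rem _ (crit s As)) /= hornerD hornerN hornerZ divfK // subrr.
  by rewrite mul0r mulr0.
have N0 : N 0 = meridian_normal f x by rewrite /N scale0r addr0.
have N1 : N 1 = meridian_normal f x' by rewrite /N scale1r addrCA subrr addr0.
have dE : det3 n (meridian_normal f x) (meridian_normal f x') = A.[0] * B.[1] - A.[1] * B.[0].
  apply: etrans (det3_cross x1 e _ _) _.
  rewrite -(AE 0) -(AE 1) -(BE 0) -(BE 1) N0 N1.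
  move: (dot x1 _) (dot e _) (dot x1 _) (dot e _) => p q r s; ring.
rewrite dE => /eqP; rewrite mulf_eq0 => /orP[/eqP->|].
  by rewrite !horner0 !mul0r subrr.
rewrite prodf_seq_eq0 => /hasP [r _ /= /eqP/subr0_eq ->].
by rewrite !hornerZ; ring.
Qed.

(** If some [meridian_normal f x1] is nonzero, the axis is the common trace of the
    other planes on the plane orthogonal to it; if there is no other plane, any
    line of that plane will do.  If the normal vanishes everywhere, any line of
    space will do. *)
Lemma normals_axis : exists2 a : E3, a != 0 & forall x, dot a (meridian_normal f x) = 0.
Proof.
have [[x1 n1]|W0] := pselect (exists x, meridian_normal f x != 0); last first.
  have [a a0 _] := exists_orthogonal (0 : E3); exists a => // x.
  have [->|Wx] := eqVneq (meridian_normal f x) 0; first by rewrite dot0r.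
  by case: W0; exists x.
have [[x0 a0]|par] := pselect (exists x, cross (meridian_normal f x1) (meridian_normal f x) != 0).
  by exists (cross (meridian_normal f x1) (meridian_normal f x0)) => // x; exact: normals_coplanar.
have [a a0 an] := exists_orthogonal (meridian_normal f x1).
exists a => [|x]; first exact: a0.
apply: (mulfI (dot_neq0 n1)); rewrite mulr0.
have cx : cross (meridian_normal f x1) (meridian_normal f x) = 0.
  by apply/eqP/negPn/negP => h; apply: par; exists x.
transitivity (dot (meridian_normal f x1) (meridian_normal f x) * dot a (meridian_normal f x1) + 
   dot (cross a (meridian_normal f x1)) (cross (meridian_normal f x1) (meridian_normal f x)) * -1).
  by move: (meridian_normal f x1) (meridian_normal f x) => u v; vec3.
by rewrite an cx dot0r mulr0 mul0r addr0.
Qed.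

End Axis.

(** * The moment about the axis *)

Section PhaseSpace.
Context {R : realType}.
Local Notation E3 := 'rV[R]_3.
Local Notation TE3 := (E3 * E3)%type.

Lemma differentiable_fst_coord (p : TE3) i : differentiable (fun q : TE3 => q.1 0 i) p.
Proof.
apply: (@differentiable_comp _ _ _ _ (fst : TE3 -> E3) (fun y : E3 => y 0 i)).
  apply: (@linear_differentiable _ _ _ (fst : {linear TE3 -> E3})) => y; exact: cvg_fst.
exact: differentiable_coord.
Qed.

Lemma differentiable_snd_coord (p : TE3) i : differentiable (fun q : TE3 => q.2 0 i) p.
Proof.
apply: (@differentiable_comp _ _ _ _ (snd : TE3 -> E3) (fun y : E3 => y 0 i)).
  apply: (@linear_differentiable _ _ _ (snd : {linear TE3 -> E3})) => y; exact: cvg_snd.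
exact: differentiable_coord.
Qed.

Lemma differentiable_dot (u v : TE3 -> E3) (p : TE3) :
  (forall i, differentiable (fun q => u q 0 i) p) ->
  (forall i, differentiable (fun q => v q 0 i) p) ->
  differentiable (fun q => dot (u q) (v q)) p.
Proof.
move=> du dv; rewrite (_ : (fun _ => _) = fun q => u q 0 0 * v q 0 0 + u q 0 1 * v q 0 1
   + u q 0 2%:R * v q 0 2%:R); last by apply/funext => q; rewrite dot3E.
by apply: differentiableD; first apply: differentiableD; apply: differentiableM.
Qed.

Lemma is_derive_pair (u v : R -> E3) t : derivable u t 1 -> derivable v t 1 ->
  is_derive t 1 (fun s => (u s, v s)) (derive1 u t, derive1 v t).
Proof.
move=> /(derivable1_diffP u t).1 du /(derivable1_diffP v t).1 dv.
have duv : differentiable (fun s => (u s, v s)) t := differentiable_pair du dv.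
split; first exact: diff_derivable.
by rewrite (deriveE _ duv) (diff_pair du dv) (derive1E' du) (derive1E' dv).
Qed.

Definition moment (a : E3) (p : TE3) : R := det3 a p.1 p.2.

Lemma differentiable_moment a p : differentiable (moment a) p.
Proof.
rewrite (_ : moment a = fun q => dot (cross a q.1) q.2) //.
apply: differentiable_dot => [i|i]; last exact: differentiable_snd_coord.
have h j k : differentiable (fun q : TE3 => a 0 j * q.1 0 k - a 0 k * q.1 0 j) p.
  apply: differentiableB; apply: differentiableM => //; exact: differentiable_fst_coord.
rewrite (_ : (fun _ => _) = fun q : TE3 =>
  if i == 0 then a 0 1 * q.1 0 2%:R - a 0 2%:R * q.1 0 1
   else if i == 1 then a 0 2%:R * q.1 0 0 - a 0 0 * q.1 0 2%:R
   else a 0 0 * q.1 0 1 - a 0 1 * q.1 0 0); last by apply/funext => q; rewrite mxE.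
by case: eqP => _; [|case: eqP => _]; exact: h.
Qed.

(** The span of the moments, the linear forms and the constants: a class of
    functions that contains the moment and is stable under differentiation, which
    makes smoothness an induction. *)
Definition momentform (G : TE3 -> R) := exists (k : R) (a u v : E3) (c : R),
  forall p, G p = k * moment a p + dot u p.1 + dot v p.2 + c.

Lemma differentiable_momentform G p : momentform G -> differentiable G p.
Proof.
move=> [k [a [u [v [c GE]]]]].
rewrite (_ : G = fun p => k * moment a p + dot u p.1 + dot v p.2 + c); last exact/funext.
apply: differentiableD => //; apply: differentiableD; first apply: differentiableD.
- by apply: differentiableM => //; exact: differentiable_moment.
- apply: differentiable_dot => // i; exact: differentiable_fst_coord.
- apply: differentiable_dot => // i; exact: differentiable_snd_coord.
Qed.

Lemma derive_momentform G w : momentform G -> momentform (fun p => 'D_w G p).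
Proof.
move=> fG; have dG p := differentiable_momentform p fG.
have [k [a [u [v [c GE]]]]] := fG.
exists 0, a, (k *: cross w.2 a), (k *: cross a w.1), (dot u w.1 + dot v w.2) => p.
apply: (derive_quadratic (c0 := G p) (c2 := k * moment a w) (dG p)) => t.
rewrite !GE /moment /=; case: p w => x y [x' y'] /=; vec3.
Qed.

Lemma smooth_moment a : smooth (moment a).
Proof.
suff H s : momentform (iter_derive s (moment a)).
  by move=> s p; exact/differentiable_momentform.
elim: s => [|w s IH]; last exact: derive_momentform.
by exists 1, a, 0, 0, 0 => p; rewrite !dot0l mul1r !addr0.
Qed.

Lemma derive_moment a p w :
  'D_w (moment a) p = det3 a w.1 p.2 + det3 a p.1 w.2.
Proof.
apply: (derive_quadratic (c0 := moment a p) (c2 := moment a w) (differentiable_moment a p)) => t.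
by rewrite /moment /=; case: p w => x y [x' y'] /=; vec3.
Qed.

Lemma derive_energy (p w : TE3) : 'D_w (@energy R) p = 2 * dot p.2 w.2.
Proof.
have E : @energy R = fun q => dot q.2 q.2 by apply/funext => q; exact: enorm_sqr.
apply: (derive_quadratic (c0 := energy p) (c2 := energy w)).
  rewrite E; apply: differentiable_dot => i; exact: differentiable_snd_coord.
by move=> t; rewrite E; case: p w => x y [x' y'] /=; vec3.
Qed.

Context (f : E3 -> R) (a : E3) (sf : smooth f)
  (axis : forall x, dot a (meridian_normal f x) = 0).

(** The rotations around [a] preserve the level sets of [f]. *)
Lemma axis_tangent x : dot (grad f x) (cross a x) = 0.
Proof. by rewrite -dot_cross_rot; exact: axis. Qed.

Lemma vertical_tangent x v w : dot (grad f x) w = 0 -> phase_tangent f (x, v) (0, w).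
Proof.
move=> gw.
have dfst (q : TE3) (h : E3 -> R) : differentiable h q.1 -> differentiable (fun q : TE3 => h q.1) q.
  move=> dh; apply: (@differentiable_comp _ _ _ _ (fst : TE3 -> E3) h) => //.
  apply: (@linear_differentiable _ _ _ (fst : {linear TE3 -> E3})) => y; exact: cvg_fst.
split.
  apply: (derive_quadratic (c0 := f x) (c2 := 0)).
    by apply: (dfst (x, v) f); exact: smooth_differentiable.
  by move=> t; rewrite /= scaler0 addr0 !mulr0 !addr0.
apply: (derive_quadratic (c0 := dot (grad f x) v) (c2 := 0)).
  apply: differentiable_dot => i; last exact: differentiable_snd_coord.
  apply: (dfst (x, v) (fun y => grad f y 0 i)); exact: differentiable_grad.
by move=> t; rewrite /= scaler0 addr0 dotDr dotZr gw !mulr0 !addr0.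
Qed.

(** Test the relation [A dF + B dE = 0] on vertical vectors [(0, w)] with [w]
    tangent to the surface: it reads [(A b + 2 B v, w) = 0].  The vector
    [A b + 2 B v] is itself tangent, so it vanishes, and [b], [v] are independent. *)
Lemma moment_independent x v : dot (grad f x) v = 0 -> cross (cross a x) v != 0 ->
  independent_at f (moment a) (@energy R) (x, v).
Proof.
move=> gv bv A B H; set b := cross a x in bv.
pose w := A *: b + (2 * B) *: v.
have w0 : w = 0.
  apply: dot_eq0; rewrite {1}/w dotDl !dotZl.
  have := H (0, w); rewrite derive_moment derive_energy /= => <-.
    by rewrite /det3 -/b -mulrA -dotZl; rewrite /w /b; vec3.
  by apply: vertical_tangent; rewrite dotDr !dotZr gv /b axis_tangent !mulr0 addr0.
split.
  have : A *: cross b v = 0.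
    transitivity (cross w v); first by apply: eq_rv3; rewrite /w; vec3.
    by rewrite w0 cross0l.
  by move/eqP; rewrite scaler_eq0 (negPf bv) orbF => /eqP.
have : (- (2 * B)) *: cross b v = 0.
  transitivity (cross w b); first by apply: eq_rv3; rewrite /w; vec3.
  by rewrite w0 cross0l.
move/eqP; rewrite scaler_eq0 (negPf bv) orbF oppr_eq0 mulf_eq0 pnatr_eq0 /= => /eqP //.
Qed.

(** The derivative of [(cross a gamma, gamma')] is [(cross a gamma, gamma'')], a multiple
    of [(cross a gamma, grad f)]. *)
Lemma moment_first_integral c : first_integral f c (moment a).
Proof.
split; first exact: smooth_moment.
move=> J gamma oJ iJ [lambda geo].
pose phi t := moment a (gamma t, derive1 gamma t).
have Dphi t : J t -> is_derive t 1 phi 0.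
  move=> /geo [_ d1 d2 e2].
  have Dp := is_derive_pair d1 d2.
  have := is_derive_curve (differentiable_moment a _) Dp.
  rewrite derive_moment /= e2 => h; rewrite /phi; apply: (is_derive_eq h).
  transitivity (lambda t * dot (grad f (gamma t)) (cross a (gamma t))).
    by move: (grad f _) => g; vec3.
  by rewrite axis_tangent mulr0.
have cst s t : s < t -> J s -> J t -> phi s = phi t.
  move=> st Js Jt.
  have sub r : r \in `[s, t] -> J r.
    by rewrite in_itv /= => /andP[sr rt]; apply: (iJ s t) => //; rewrite sr rt.
  have [||r _ E] := @MVT R phi (fun=> 0) s t st.
  - by move=> r rI; apply/Dphi/sub; exact: subset_itv_oo_cc.
  - by apply: derivable_within_continuous => r rI; have [] := Dphi r (sub r rI).
  by apply/esym/eqP; rewrite -subr_eq0 E mul0r.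
move=> s t Js Jt; rewrite -/(phi s) -/(phi t).
have [st|ts|->//] := ltgtP s t; first exact: cst.
by apply/esym/cst.
Qed.

End PhaseSpace.

(** * Density of the points of independence *)

Section Density.
Context {R : realType}.
Local Notation E3 := 'rV[R]_3.
Local Notation TE3 := (E3 * E3)%type.
Implicit Types (f : E3 -> R) (x v : E3).

Lemma closure_path {T : topologicalType} (A : set T) (z : R -> T) :
  {for 0, continuous z} -> (\forall s \near 0^'+, A (z s)) -> closure A (z 0).
Proof.
move=> cz Az B nB.
have nz : \forall s \near 0^'+, B (z s).
  by apply: cvg_at_right_filter nB; exact: cz.
have [s [As Bs]] : exists s, A (z s) /\ B (z s).
  by apply: (@filter_ex _ (0 : R)^'+); near=> s; split; near: s.
by exists (z s).
Unshelve. all: by end_near. Qed.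

Lemma continuous_pair (u v : R -> E3) (t : R) : {for t, continuous u} ->
  {for t, continuous v} -> {for t, continuous (fun s => (u s, v s))}.
Proof. by move=> cu cv; exact: (cvg_pair cu cv). Qed.

Lemma differentiable_gradient f x : smooth f -> differentiable (grad f) x.
Proof.
move=> sf.
rewrite (_ : grad f = fun y => \sum_(i < 3) grad f y 0 i *: delta_mx 0 i); last first.
  by apply/funext => y; rewrite [LHS]row_sum_delta.
pose h (i : 'I_3) (y : E3) : E3 := grad f y 0 i *: delta_mx 0 i.
have -> : (fun y => \sum_(i < 3) grad f y 0 i *: delta_mx 0 i) = \sum_(i < 3) h i.
  by apply/funext => y; rewrite fct_sumE.
apply: differentiable_sum => i; apply: differentiableZl; exact: differentiable_grad.
Qed.

(** Homogeneity of an arbitrary real degree [m], for positive factors. *)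
Lemma euler_exp f (m tau : R) x : smooth f -> euler m f ->
  f (expR tau *: x) = expR (m * tau) * f x.
Proof.
move=> sf ef.
have df y : differentiable f y by exact: smooth_differentiable.
pose psi (s : R) := f (expR s *: x) * expR (- (m * s)).
have Dpsi (s : R) : is_derive s 1 psi 0.
  have dexp : differentiable (expR : R -> R) s by apply/derivable1_diffP.
  have Dg : is_derive s 1 (fun s => expR s *: x) (expR s *: x).
    split; first exact/diff_derivable/differentiableZl.
    by rewrite (deriveZl _ _ dexp) derive_val.
  have h := is_derive_curve (df (expR s *: x)) Dg.
  rewrite /psi; apply: is_derive_eq.
  rewrite -dot_grad // dotC ef /GRing.scale /=; ring.
have := is_derive_0_is_cst tau 0 Dpsi; rewrite /psi mulr0 oppr0 expR0 scale1r mulr1.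
by move=> <-; rewrite mulrCA -expRD subrr expR0 mulr1.
Qed.

(** Any line through a point of the surface can be projected radially onto the
    surface, with the factor [(c / f) ^ (1 / m)]. *)
Lemma surface_path f (m c : R) x xi : smooth f -> euler m f -> m != 0 -> c != 0 -> f x = c ->
  exists sigma : R -> R, [/\ {for 0, continuous sigma}, sigma 0 = 1, forall s, sigma s != 0 &
    \forall s \near 0^'+, f (sigma s *: (x + s *: xi)) = c].
Proof.
move=> sf ef m0 c0 fx.
pose r (s : R) := c / f (x + s *: xi).
have cf : {for 0, continuous (fun s : R => f (x + s *: xi))}.
  have [d _] := @is_derive_line _ _ f x xi 0 (smooth_differentiable _ sf).
  by apply: differentiable_continuous; apply/derivable1_diffP.
have r0 : r 0 = 1 by rewrite /r scale0r addr0 fx divff.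
have cr : {for 0, continuous r}.
  apply: cvgM; first exact: cvg_cst.
  by apply: cvgV => //; rewrite scale0r addr0 fx.
pose sigma s := expR (ln (r s) / m).
exists sigma; split.
- apply: continuous_comp; last exact: continuous_expR.
  apply: cvgMl; apply: continuous_comp; first exact: cr.
  by rewrite r0; apply: continuous_ln.
- by rewrite /sigma r0 ln1 mul0r expR0.
- by move=> s; rewrite lt0r_neq0 // expR_gt0.
have rpos : \forall s \near 0^'+, 0 < r s.
  have H : r @ 0^'+ --> r 0 by apply: cvg_at_right_filter.
  apply: (H [set u | 0 < u]); rewrite r0; exact: lt_nbhsr.
near=> s.
have rs : 0 < r s by near: s.
have fs : f (x + s *: xi) != 0.
  by apply: contraTneq rs; rewrite /r => ->; rewrite invr0 mulr0 ltxx.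
by rewrite /sigma (euler_exp _ _ sf ef) [m * _]mulrC divfK // lnK ?posrE // divfK.
Unshelve. all: by end_near. Qed.

Context (f : E3 -> R) (m c : R) (a : E3) (sf : smooth f) (ef : euler m f)
  (c0 : c != 0) (a0 : a != 0) (axis : forall x, dot a (meridian_normal f x) = 0).

Let off_axis : set TE3 := phase_space f c `&` [set p | cross a p.1 != 0].

(** At a point of the axis, move in a direction orthogonal to it and project the
    velocity on the new tangent plane.  The degree [m <= 0] is separate: [f] is
    then constant, the surface is all of space and no radial projection is
    needed. *)
Lemma off_axis_dense : phase_space f c `<=` closure off_axis.
Proof.
move=> [x v] [/= fx gv].
have [ax|ax] := eqVneq (cross a x) 0; last by apply: subset_closure.
have [xi xi0 axi] := exists_orthogonal a.
have axi0 : cross a xi != 0 by exact: cross_orthogonal_neq0.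
have off (k s : R) : k != 0 -> 0 < s -> cross a (k *: (x + s *: xi)) != 0.
  move=> k0 s0; have -> : cross a (k *: (x + s *: xi)) = k *: (cross a x + s *: cross a xi).
    by apply: eq_rv3; vec3.
  by rewrite ax add0r !scaler_eq0 negb_or k0 negb_or axi0 lt0r_neq0.
have cl : continuous (fun s : R => x + s *: xi).
  move=> s; apply: cvgD; [exact: cvg_cst|apply: cvgZr_tmp; exact: cvg_id].
have [m0|m0] := leP m 0.
  have fE y : f y = f 0 := euler_le0_const y sf ef m0.
  have gE y : grad f y = 0.
    apply/rowP => i; rewrite !mxE (_ : f = cst (f 0)) ?derive_cst //.
    exact/funext.
  have := @closure_path _ off_axis (fun s => (x + s *: xi, v)).
  rewrite scale0r addr0; apply.
    by apply: continuous_pair; [exact: cl|exact: cvg_cst].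
  near=> s; split; first by split; rewrite /= ?gE ?dot0l // fE -(fE x).
  by rewrite /= -[x + _]scale1r off ?oner_neq0.
have [sigma [csig sig0 signz fsig]] := surface_path xi sf ef (lt0r_neq0 m0) c0 fx.
pose y s := sigma s *: (x + s *: xi); pose p s := grad f (y s).
pose z s := (y s, v - (dot (p s) v / dot (p s) (p s)) *: p s).
have y0 : y 0 = x by rewrite /y sig0 scale1r scale0r addr0.
have z0 : z 0 = (x, v) by rewrite /z /p y0 gv mul0r scale0r subr0.
have pnz u : f u = c -> grad f u != 0.
  move=> fu; apply/eqP => gu; have := ef u; rewrite gu dot0r fu => /esym/eqP.
  by rewrite mulf_eq0 (negPf c0) (gt_eqF m0).
rewrite -z0; apply: closure_path.
  have cy : {for 0, continuous y} by apply: cvgZ; [exact: csig|exact: cl].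
  have cp : {for 0, continuous p}.
    apply: (@continuous_comp _ _ _ y (grad f)) => //.
    exact/differentiable_continuous/differentiable_gradient.
  have cpi i : {for 0, continuous (fun s => p s 0 i)}.
    by apply: (@continuous_comp _ _ _ p (fun u : E3 => u 0 i)) => //; exact: coord_continuous.
  have cdot (q : R -> E3) : (forall i, {for 0, continuous (fun s => q s 0 i)}) ->
      {for 0, continuous (fun s => dot (p s) (q s))}.
    move=> cq; rewrite (_ : (fun _ => _) = fun s => p s 0 0 * q s 0 0 + p s 0 1 * q s 0 1
     + p s 0 2%:R * q s 0 2%:R); last by apply/funext => s; rewrite dot3E.
    by apply: cvgD; first apply: cvgD; apply: cvgM; (exact: cpi || exact: cq).
  apply: continuous_pair; first exact: cy.
  apply: cvgB; first exact: cvg_cst.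
  apply: cvgZ; last exact: cp.
  apply: cvgM; first by apply: cdot => i; exact: cvg_cst.
  apply: cvgV; last exact: cdot.
  by rewrite dot_neq0 // /p y0 pnz.
near=> s.
have fy : f (y s) = c by near: s.
split; last by rewrite /= off.
split => //=; rewrite -/(p s) dotDr -scaleNr dotZr mulNr divfK ?subrr //.
exact/dot_neq0/pnz.
Unshelve. all: by end_near. Qed.

(** Tilt the velocity by a tangent vector [q] that is not proportional to
    [cross a x]. *)
Lemma independent_dense : off_axis `<=`
  closure (phase_space f c `&` [set p | independent_at f (moment a) (@energy R) p]).
Proof.
move=> [x v] [[/= fx gv] b0]; set b := cross a x in b0.
have gb : dot (grad f x) b = 0 := axis_tangent axis x.
have [bv|bv] := eqVneq (cross b v) 0; last first.
  by apply: subset_closure; split => //; exact: moment_independent.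
have [q gq bq] : exists2 q, dot (grad f x) q = 0 & cross b q != 0.
  have [g0|g0] := eqVneq (grad f x) 0.
    have [q q0 qb] := exists_orthogonal b.
    by exists q; [rewrite g0 dot0l|exact: cross_orthogonal_neq0].
  (* Where the gradient is nonzero, the tangent plane is spanned by [b] and its
     rotation by a right angle. *)
  exists (cross (grad f x) b); first exact: dot_cross1.
  apply: cross_orthogonal_neq0 => //; last by rewrite dotC dot_cross2.
  exact: cross_orthogonal_neq0 (etrans (dotC _ _) gb).
set A := _ `&` _.
have := @closure_path _ A (fun s : R => (x, v + s *: q)).
rewrite scale0r addr0; apply.
  apply: continuous_pair; first exact: cvg_cst.
  by apply: cvgD; [exact: cvg_cst|apply: cvgZr_tmp; exact: cvg_id].
near=> s.
have gs : dot (grad f x) (v + s *: q) = 0 by rewrite dotDr dotZr gv gq mulr0 addr0.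
split; first by split.
apply: (moment_independent sf axis gs).
have -> : cross (cross a x) (v + s *: q) = cross b v + s *: cross b q.
  by rewrite -/b; apply: eq_rv3; vec3.
by rewrite bv add0r scaler_eq0 negb_or bq andbT lt0r_neq0.
Unshelve. all: by end_near. Qed.

Lemma moment_functionally_independent : functionally_independent f c (moment a) (@energy R).
Proof.
move=> p /off_axis_dense; rewrite [X in _ -> X p](closure_id _).1; last exact: closed_closure.
exact: closure_subset independent_dense _.
Qed.

End Density.

Unset Implicit Arguments.

Theorem proposition3p1 (R : realType) (f : 'rV[R]_3 -> R) (m c : R)
    (f_smooth : smooth f)
    (f_homogeneous : forall x : 'rV[R]_3, dot x (grad f x) = m * f x)
    (c_neq0 : c != 0)
    (grad_f_depends : exists g : R -> R -> R,
       forall x : 'rV[R]_3, enorm (grad f x) ^+ 2 = g (f x) (enorm x)) :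
  geodesic_flow_integrable f c.
Proof.
have planes x := hess_in_plane x f_smooth grad_f_depends.
have [a a0 axis] := normals_axis f_smooth f_homogeneous planes.
exists (moment a); split; first exact: moment_first_integral.
exact: moment_functionally_independent.
Qed.
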